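(* Consider a deterministic positive semilinear problem with data $(X,U,U(\cdot),f,g,\alpha,\widehat{\mathcal M})$ satisfying Closure and Attainability, Stabilizability, State Space Structure, and Observability (all as defined in the context), and let $c^*$ be its optimal cost vector. Consider the policy iteration algorithm, which starts with a policy $\mu^0\in\widehat{\mathcal M}$ such that $\alpha A_{\mu^0}$ is stable and, at iteration $k=0,1,\dots$, computes the cost vector $c_{\mu^k}$ of $\mu^k$ by $$c_{\mu^k}'=q_{\mu^k}'(I-\alpha A_{\mu^k})^{-1}$$ and then selects a policy $\mu^{k+1}\in\widehat{\mathcal M}$ satisfying $$G_{\mu^{k+1}}(c_{\mu^k})=G(c_{\mu^k}).$$ This algorithm is well-defined, i.e., for every $k$, $\mu^k\in\widehat{\mathcal M}$ and $\alpha A_{\mu^k}$ is stable. Moreover, $c_{\mu^k}\to c^*$ as $k\to\infty$. If in addition $\widehat{\mathcal M}$ consists of a finite number of policies, then there exists some $\bar k$ such that for all $k\ge\bar k$ the policies $\mu^k$ are optimal.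
   Context: Notation: $\mathbb R^n_+$ is the set of vectors in $\mathbb R^n$ with nonnegative components; a prime denotes transposition; $I$ is the identity matrix. Deterministic positive semilinear problem: the state space $X$ is a subset of $\mathbb R^n_+$, $U$ is a control space, and for each $x\in X$, $U(x)\subset U$ is a nonempty control constraint set. The functions $f:X\times U\to\mathbb R^n$ and $g:X\times U\to\mathbb R$ satisfy $f(x,u)\in X$ and $g(x,u)\ge 0$ for all $x\in X$, $u\in U(x)$; $\alpha\in(0,1]$ is a scalar. For $x_0\in X$, the problem is to minimize $\sum_{k=0}^\infty\alpha^k g(x_k,u_k)$ over control sequences $\{u_k\}$ subject to $x_{k+1}=f(x_k,u_k)$, $u_k\in U(x_k)$, $k=0,1,\dots$. $J^*(x_0)$ denotes the optimal cost (infimum) starting from $x_0$. A (stationary) policy is a function $\mu:X\to U$ with $\mu(x)\in U(x)$ for all $x\in X$; its cost function is $J_\mu(x_0)=\sum_{k=0}^\infty\alpha^k g(x_k,\mu(x_k))$ with $x_{k+1}=f(x_k,\mu(x_k))$; $\mu$ is optimal if $J_\mu(x)=J^*(x)$ for all $x\in X$. $\widehat{\mathcal M}$ is a given set of policies such that for every $\mu\in\widehat{\mathcal M}$ there exist an $n\times n$ nonnegative matrix $A_\mu$ and a vector $q_\mu\in\mathbb R^n$ with $f(x,\mu(x))=A_\mu x$ and $g(x,\mu(x))=q_\mu'x$ for all $x\in X$. $\widehat{\mathcal J}$ is the set of functions $J(x)=c'x$ on $X$ with $c\in\mathbb R^n_+$. A square matrix is stable if all its eigenvalues lie strictly within the unit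 circle. Assumptions: Closure and Attainability: for every $c\in\mathbb R^n_+$, the function $x\mapsto\min_{u\in U(x)}[g(x,u)+\alpha c'f(x,u)]$ belongs to $\widehat{\mathcal J}$, i.e., equals $\hat c'x$ for some unique $\hat c\in\mathbb R^n_+$; $\hat c$ depends continuously on $c$; and there is a policy $\mu\in\widehat{\mathcal M}$ with $\mu(x)\in\arg\min_{u\in U(x)}[g(x,u)+\alpha c'f(x,u)]$ for all $x\in X$. Stabilizability: there exists $\hat\mu\in\widehat{\mathcal M}$ such that $\alpha A_{\hat\mu}$ is stable. State Space Structure: for every $v\in\mathbb R^n_+$ there exist $x\in X$ and a scalar $s\ge0$ with $sx=v$. Observability: there exists an integer $N$ such that for every nonzero $x_0\in X$ the optimal cost of the $N$-stage problem of minimizing $\sum_{k=0}^{N-1}\alpha^k g(x_k,u_k)$ starting from $x_0$ is strictly positive. For $\mu\in\widehat{\mathcal M}$, $G_\mu(c)=q_\mu+\alpha A_\mu'c$. The mapping $G:\mathbb R^n_+\to\mathbb R^n_+$ is defined by letting $G(c)$ be the unique vector with $G(c)'x=\min_{u\in U(x)}[g(x,u)+\alpha c'f(x,u)]$ for all $x\in X$. The optimal cost vector $c^*$ is the vector in $\mathbb R^n_+$ such that $J^*(x)=(c^* )'x$ for all $x\in X$; under the assumptions above it exists and is the unique solution of $c=G(c)$ in $\mathbb R^n_+$. *)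

(* Defs.v *)
From HB Require Import structures.
From mathcomp Require Import all_boot all_order all_algebra.
From mathcomp Require Import complex.
From mathcomp Require Import all_classical all_reals all_analysis.

Set Implicit Arguments.
Unset Strict Implicit.
Unset Printing Implicit Defensive.

Import Order.TTheory GRing.Theory Num.Theory.
Import numFieldNormedType.Exports.

Local Open Scope classical_set_scope.
Local Open Scope ring_scope.

Section LinearAlgebra.
Context {R : realType}.

Definition orthant (n : nat) : set 'cV[R]_n := [set c | forall i, 0 <= c i 0].

Definition dot (n : nat) (c x : 'cV[R]_n) : R := (c^T *m x) 0 0.

Definition nonneg_mx (n : nat) (A : 'M[R]_n) : Prop := forall i j, 0 <= A i j.

(* The eigenvalues are the complex ones, so A is mapped to R[i]. *)
Definition stable_mx (n : nat) (A : 'M[R]_n) : Prop :=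
  forall z : R[i], eigenvalue (map_mx (real_complex R) A) z -> `|z| < 1.

Definition is_min (S : set R) (m : R) : Prop := S m /\ lbound S m.

End LinearAlgebra.

(* The state space is a set of vectors used as a (sub)type, so that policies,
   and hence sets of policies, only involve values at states.  The values of
   [dynamics] and [stage_cost] at inadmissible controls are unconstrained. *)
Record semilinear_problem (R : realType) (n : nat) := SemilinearProblem {
  state : set 'cV[R]_n;
  control : Type;
  admissible : state -> set control;
  dynamics : state -> control -> 'cV[R]_n;
  stage_cost : state -> control -> R;
  discount : R;
  good_policy : set (state -> control);
  state_ge0 : state `<=` @orthant R n;
  admissible_neq0 : forall x, admissible x !=set0;
  dynamics_state : forall x u, admissible x u -> state (dynamics x u);
  stage_cost_ge0 : forall x u, admissible x u -> 0 <= stage_cost x u;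
  discount_gt0 : 0 < discount;
  discount_le1 : discount <= 1;
  good_policy_admissible :
    forall mu, good_policy mu -> forall x, admissible x (mu x);
  good_policy_linear :
    forall mu, good_policy mu -> exists (A : 'M[R]_n) (q : 'cV[R]_n),
      nonneg_mx A /\
      forall x : state, dynamics x (mu x) = A *m val x /\
                        stage_cost x (mu x) = dot q (val x)
}.

Section SemilinearProblem.
Context {R : realType} {n : nat} (P : semilinear_problem R n).

Local Notation X := (state P).
Local Notation U := (control P).
Local Notation alpha := (discount P).

(* [insubd] falls back on x only when [dynamics x u] leaves the state space,
   which never happens for an admissible u. *)
Definition next_state (x : X) (u : U) : X := insubd x (dynamics x u).

Fixpoint trajectory (x0 : X) (u : nat -> U) (k : nat) : X :=
  if k is k'.+1 then next_state (trajectory x0 u k') (u k') else x0.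

Definition optimal_cost (x0 : X) : \bar R :=
  ereal_inf [set (\sum_(0 <= k <oo)
                    (alpha ^+ k * stage_cost (trajectory x0 u k) (u k))%:E)%E
            | u in [set u : nat -> U |
                forall k, admissible (trajectory x0 u k) (u k)]].

Definition optimal_cost_upto (N : nat) (x0 : X) : \bar R :=
  ereal_inf [set (\sum_(0 <= k < N)
                    alpha ^+ k * stage_cost (trajectory x0 u k) (u k))%:E
            | u in [set u : nat -> U |
                forall k, (k < N)%N -> admissible (trajectory x0 u k) (u k)]].

Definition policy_trajectory (mu : X -> U) (x0 : X) (k : nat) : X :=
  iter k (fun x => next_state x (mu x)) x0.

Definition policy_cost (mu : X -> U) (x0 : X) : \bar R :=
  (\sum_(0 <= k <oo)
     (alpha ^+ k * stage_cost (policy_trajectory mu x0 k)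
                              (mu (policy_trajectory mu x0 k)))%:E)%E.

Definition optimal_policy (mu : X -> U) : Prop :=
  (forall x, admissible x (mu x)) /\
  (forall x, policy_cost mu x = optimal_cost x).

Definition policy_mx (mu : X -> U) : 'M[R]_n :=
  xget 0 [set A : 'M[R]_n |
    nonneg_mx A /\ forall x : X, dynamics x (mu x) = A *m val x].

Definition policy_vec (mu : X -> U) : 'cV[R]_n :=
  xget 0 [set q : 'cV[R]_n |
    forall x : X, stage_cost x (mu x) = dot q (val x)].

Definition policy_stable (mu : X -> U) : Prop :=
  stable_mx (alpha *: policy_mx mu).

Definition Qvalue (c : 'cV[R]_n) (x : X) (u : U) : R :=
  stage_cost x u + alpha * dot c (dynamics x u).

Definition bellman_vec (c ch : 'cV[R]_n) : Prop :=
  orthant ch /\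
  forall x : X, is_min [set Qvalue c x u | u in admissible x] (dot ch (val x)).

Definition bellman (c : 'cV[R]_n) : 'cV[R]_n := xget 0 (bellman_vec c).

Definition policy_bellman (mu : X -> U) (c : 'cV[R]_n) : 'cV[R]_n :=
  policy_vec mu + alpha *: ((policy_mx mu)^T *m c).

Definition greedy (c : 'cV[R]_n) (mu : X -> U) : Prop :=
  forall x : X, admissible x (mu x) /\
    forall u, admissible x u -> Qvalue c x (mu x) <= Qvalue c x u.

Definition closure_attainability : Prop :=
  [/\ forall c, orthant c -> exists! ch, bellman_vec c ch,
      {within @orthant R n, continuous bellman}
    & forall c, orthant c -> exists mu, good_policy mu /\ greedy c mu].

Definition stabilizability : Prop :=
  exists mu, good_policy mu /\ policy_stable mu.

Definition state_space_structure : Prop :=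
  forall v : 'cV[R]_n, orthant v ->
    exists (x : X) (s : R), 0 <= s /\ s *: val x = v.

Definition observability : Prop :=
  exists N : nat, forall x0 : X, val x0 != 0 -> (0 < optimal_cost_upto N x0)%E.

Definition optimal_cost_vec : 'cV[R]_n :=
  xget 0 [set c | orthant c /\
                  forall x : X, optimal_cost x = (dot c (val x))%:E].

Definition policy_cost_vec (mu : X -> U) : 'cV[R]_n :=
  ((policy_vec mu)^T *m invmx (1%:M - alpha *: policy_mx mu))^T.

Definition policy_improvement (mu nu : X -> U) : Prop :=
  good_policy nu /\
  policy_bellman nu (policy_cost_vec mu) = bellman (policy_cost_vec mu).

(* [mu 0], ..., [mu K] are produced by K iterations of the algorithm. *)
Definition policy_iteration_upto (K : nat) (mu : nat -> X -> U) : Prop :=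
  [/\ good_policy (mu 0%N), policy_stable (mu 0%N)
    & forall k, (k < K)%N -> policy_improvement (mu k) (mu k.+1)].

Definition policy_iteration (mu : nat -> X -> U) : Prop :=
  [/\ good_policy (mu 0%N), policy_stable (mu 0%N)
    & forall k, policy_improvement (mu k) (mu k.+1)].

(* The iteration can be carried out from mu: the inverse exists, the cost
   vector is in the domain of [bellman], and a next policy can be selected. *)
Definition iteration_defined (mu : X -> U) : Prop :=
  [/\ 1%:M - alpha *: policy_mx mu \in unitmx,
      orthant (policy_cost_vec mu)
    & exists nu, policy_improvement mu nu].

End SemilinearProblem.

(* Main.v *)
(* A nonnegative matrix is stable iff it maps some positive vector v strictly
   below itself, and then y >= B y forces y >= 0.  Write B for the transpose of
   the discounted matrix of a policy.  If c >= 0 and G_mu c <= c, observability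
   gives B^N c < c, so v = sum_(k < N) B^k c witnesses the stability of mu.
   Applied to G_nu c = G c <= c with c the cost vector of a stable policy, this
   makes the improved policy nu stable, and comparison gives
   c_nu <= G c <= c.  The cost vectors thus decrease to a fixed point of G, by
   continuity of G.  Fixed points are unique by comparison, and the fixed point
   is the optimal cost vector: it is at most the cost of any control sequence,
   because the finite-horizon values G^k 0 increase to it, and at least the cost
   of its greedy policy. *)
Require Import Defs.
From mathcomp Require Import all_boot all_order all_algebra.
From mathcomp Require Import complex ring lra.
From mathcomp Require Import all_classical all_reals all_analysis.
Import Order.TTheory GRing.Theory Num.Theory.
Import numFieldNormedType.Exports.
Local Open Scope classical_set_scope.
Local Open Scope ring_scope.

(** * Nonnegative matrices: contraction of a positive vector and stability *)

Definition le_vec {R : realType} {n : nat} (x y : 'cV[R]_n) : Prop :=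
  forall i, x i 0 <= y i 0.

(** For nonnegative [B] this is equivalent to stability, by [contracting_stable] and
    [stable_contracting]. It is a real certificate that replaces complex eigenvalues in every later
    comparison. *)
Definition contracting {R : realType} {n : nat} (B : 'M[R]_n) : Prop :=
  exists v : 'cV[R]_n,
    (forall i, 0 < v i 0) /\ (forall i, (B *m v) i 0 < v i 0).

(** With [s = sum_i |b_i| / a_i], one has [b_i <= a_i s < a_i (1 + s)], so [e = 1 / (1 + s)] serves
    all indices at once. *)
Lemma exists_small_scale (R : realType) (n : nat) (a b : 'I_n -> R) :
  (forall i, 0 < a i) -> exists2 e, 0 < e & forall i, e * b i < a i.
Proof.
move=> a_gt0; pose s := \sum_i `|b i| / a i.
have s_ge0 : 0 <= s.
  by apply: sumr_ge0 => i _; rewrite divr_ge0 // ltW.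
have s1_gt0 : 0 < 1 + s by rewrite ltr_pwDl.
exists (1 + s)^-1; first by rewrite invr_gt0.
move=> i; rewrite mulrC ltr_pdivrMr //.
apply: (@le_lt_trans _ _ (a i * s)); last first.
  by rewrite ltr_pM2l // ltrDr.
rewrite (le_trans (ler_norm _)) // -ler_pdivrMl // mulrC /s (bigD1 i) //=.
by rewrite lerDl sumr_ge0 // => j _; rewrite divr_ge0 // ltW.
Qed.

Lemma nonneg_mx_mulmx_ge0 (R : realType) (n : nat) (B : 'M[R]_n) v :
  nonneg_mx B -> orthant v -> orthant (B *m v).
Proof.
move=> B0 v0 i; rewrite mxE; apply: sumr_ge0 => j _; exact: mulr_ge0.
Qed.

Lemma nonneg_mx_mulmx_le (R : realType) (n : nat) (B : 'M[R]_n) u v :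
  nonneg_mx B -> le_vec u v -> le_vec (B *m u) (B *m v).
Proof.
move=> B0 uv i; rewrite !mxE; apply: ler_sum => j _.
by rewrite ler_wpM2l.
Qed.

(* At an index minimizing y_i / v_i =: m, a negative m would give
   y_i >= (B y)_i >= m (B v)_i > m v_i = y_i. *)
Lemma contracting_ge0 (R : realType) (n : nat) (B : 'M[R]_n) y :
  nonneg_mx B -> contracting B -> le_vec (B *m y) y -> orthant y.
Proof.
move=> B0 [v [v0 Bv]] By i0.
case: (@Order.TotalTheory.arg_minP _ _ _ i0 predT (fun i => y i 0 / v i 0) isT).
move=> i _ /(_ _ isT) imin.
set m := y i 0 / v i 0 in imin.
have my j : m * v j 0 <= y j 0 by rewrite -ler_pdivlMr // imin.
have [m0|m0] := leP 0 m.
  by apply: le_trans (my i0); rewrite mulr_ge0 // ltW.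
have : m * v i 0 < y i 0.
  apply: lt_le_trans (By i); apply: (@lt_le_trans _ _ (m * (B *m v) i 0)).
    by rewrite ltr_nM2l.
  rewrite !mxE mulr_sumr; apply: ler_sum => j _.
  by rewrite mulrCA ler_wpM2l.
by rewrite /m divfK ?ltxx // gt_eqF.
Qed.

(** A kernel vector of [1 - B] and its negative are both fixed by [B], hence both nonnegative by
    [contracting_ge0], hence zero. *)
Lemma contracting_unitmx (R : realType) (n : nat) (B : 'M[R]_n) :
  nonneg_mx B -> contracting B -> 1%:M - B \in unitmx.
Proof.
move=> B0 cB; rewrite -unitmx_tr -row_free_unit; apply: inj_row_free => w.
move=> /(congr1 trmx); rewrite trmx_mul trmxK trmx0 mulmxBl mul1mx => /subr0_eq wB.
have w0 : orthant w^T by apply: (contracting_ge0 _ _ _ _ B0 cB) => i; rewrite -wB.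
have wN0 : orthant (- w^T).
  by apply: (contracting_ge0 _ _ _ _ B0 cB) => i; rewrite mulmxN -wB.
apply/rowP => j; apply/eqP; rewrite mxE eq_le.
by move: (w0 j) (wN0 j); rewrite !mxE oppr_ge0 => -> ->.
Qed.

(* For w B = z w,
   |z| sum_j v_j |w_j| <= sum_i |w_i| (B v)_i < sum_i v_i |w_i|. *)
Lemma contracting_stable (R : realType) (n : nat) (B : 'M[R]_n) :
  nonneg_mx B -> contracting B -> stable_mx B.
Proof.
move=> B0 [v [v0 Bv]] z /eigenvalueP[w wB wn0].
have c_ge0 (x : R) : 0 <= x -> 0 <= x%:C%C by rewrite (lecR 0).
pose S := \sum_i (v i 0)%:C%C * `|w 0 i|.
have /rV0Pn[i0 wi0] := wn0.
have S0 : 0 < S.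
  rewrite /S (bigD1 i0) //= ltr_pwDl //.
    by rewrite mulr_gt0 ?normr_gt0 // (ltcR 0).
  by apply: sumr_ge0 => i _; rewrite mulr_ge0 // c_ge0 // ltW.
rewrite -(ltr_pM2r S0) mul1r.
apply: (@le_lt_trans _ _ (\sum_i ((B *m v) i 0)%:C%C * `|w 0 i|)).
  rewrite /S mulr_sumr.
  under [leRHS]eq_bigr do rewrite mxE rmorph_sum mulr_suml.
  rewrite exchange_big /=; apply: ler_sum => j _.
  rewrite mulrCA -normrM.
  have -> : z * w 0 j = (z *: w) 0 j by rewrite mxE.
  rewrite -wB mxE -ler_pdivlMl ?(ltcR 0) // mulr_sumr.
  apply: le_trans (ler_norm_sum _ _ _) _; apply: ler_sum => i _.
  rewrite ler_pdivlMl ?(ltcR 0) // normrM [in leLHS]mxE rmorphM /=.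
  rewrite [`|_%:C%C|]ger0_norm ?c_ge0 //.
  by rewrite le_eqVlt; apply/orP; left; apply/eqP; ring.
rewrite /S (bigD1 i0) //= [ltRHS](bigD1 i0) //=; apply: ltr_leD.
  by rewrite ltr_pM2r ?normr_gt0 // ltcR.
by apply: ler_sum => i _; rewrite ler_wpM2r // lecR ltW.
Qed.

Lemma stable_mx_tr (R : realType) (n : nat) (B : 'M[R]_n) :
  stable_mx B -> stable_mx B^T.
Proof.
move=> sB z; rewrite eigenvalue_root_char -map_trmx => zB; apply: sB.
move: zB; rewrite eigenvalue_root_char.
rewrite /char_poly -[in X in _ -> X]det_tr /char_poly_mx linearB /= tr_scalar_mx.
by rewrite -map_trmx.
Qed.

(** A nonzero [w] with [w = t w B] would make [1 / t >= 1] an eigenvalue of [B]. *)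
Lemma stable_mx_unitmx (R : realType) (n : nat) (B : 'M[R]_n) (t : R) :
  stable_mx B -> 0 <= t <= 1 -> 1%:M - t *: B \in unitmx.
Proof.
move=> sB /andP[t0 t1]; rewrite -row_free_unit; apply: inj_row_free => w.
rewrite mulmxBr mulmx1 -scalemxAr => /subr0_eq wB.
apply/eqP/negPn/negP => wn0.
have tn0 : t != 0 by apply: contraNneq wn0 => t00; rewrite wB t00 scale0r.
have : eigenvalue B t^-1.
  apply/eigenvalueP; exists w => //.
  by rewrite {2}wB scalerA mulVf // scale1r.
rewrite -(eigenvalue_map (real_complex R)) => /sB.
rewrite normc_def /= expr0n addr0 sqrtr_sqr ger0_norm ?invr_ge0 //.
rewrite ltcR; apply/negP; rewrite -leNgt invf_ge1 //.
by rewrite lt_neqAle eq_sym tn0.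
Qed.

(* The set T of t in [0, 1] with t B contracting is relatively open.  It contains
   its supremum s: x = (1 - s B)^-1 1 satisfies x >= t B x for t in T close to s,
   hence x >= 0, and then s B x = x - 1 < x. *)
Lemma stable_contracting (R : realType) (n : nat) (B : 'M[R]_n) :
  nonneg_mx B -> stable_mx B -> contracting B.
Proof.
move=> B0 sB.
pose T := [set t : R | 0 <= t <= 1 /\ contracting (t *: B)].
have T0 : T 0.
  split; first by rewrite lexx ler01.
  exists (const_mx 1); split => i; first by rewrite mxE.
  by rewrite scale0r mul0mx !mxE.
have supT : has_sup T by split; [exists 0|exists 1 => t [/andP[]]].
set s := sup T.
have s0 : 0 <= s by apply: ub_le_sup => //; case: supT.
have s1 : s <= 1 by apply: sup_le_ub => [|t [/andP[]]] //; exists 0.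
have nonnegZ t : 0 <= t -> nonneg_mx (t *: B).
  by move=> t0 i j; rewrite mxE mulr_ge0.
pose x := invmx (1%:M - s *: B) *m const_mx 1 : 'cV_n.
have xE : x = s *: B *m x + const_mx 1.
  have us : 1%:M - s *: B \in unitmx by rewrite stable_mx_unitmx // s0.
  by rewrite -[const_mx 1](mulKVmx us) -/x mulmxBl mul1mx addrC subrK.
(* Since [x - t B x = (s - t) B x + 1], this [e] keeps the difference nonnegative for any [t] in [T]
   within [e] of [s]. *)
have [e e0 ex] := exists_small_scale _ _ (fun=> 1) (fun i => - (B *m x) i 0)
  (fun=> ltr01).
have [t [/andP[t0 t1] ct] ste] := sup_adherent e0 supT.
have ts : t <= s by apply: ub_le_sup; [case: supT|split => //; rewrite t0].
have x0 : orthant x.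
  apply: (contracting_ge0 _ _ _ _ (nonnegZ _ t0) ct) => i.
  rewrite [in leRHS]xE -scalemxAl -scalemxAl !mxE.
  have := ex i; rewrite !mxE -/s in ste *.
  set b := \sum_j _ => eb.
  have : (s - t) * - b <= 1.
    have [b0|b0] := leP 0 (- b).
      rewrite (le_trans _ (ltW eb)) // ler_wpM2r //; lra.
    have : 0 <= s - t by rewrite subr_ge0.
    nra.
  lra.
have cs : contracting (s *: B).
  exists x; split => i.
    rewrite xE mxE [const_mx _ _ _]mxE ltr_wpDl //.
    exact: nonneg_mx_mulmx_ge0 (nonnegZ _ s0) x0 i.
  by rewrite [in ltRHS]xE [ltRHS]mxE [const_mx _ _ _]mxE ltrDl.
have [v [v0 Bv]] := cs.
have [s1'|s1'] := leP 1 s.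
  suff sE : s = 1 by exists v; split => // i; have := Bv i; rewrite sE scale1r.
  by apply/eqP; rewrite eq_le s1.
have [d d0 dv] := exists_small_scale _ _ (fun i => v i 0 - (s *: B *m v) i 0)
  (fun i => (B *m v) i 0) (fun i => etrans (subr_gt0 _ _) (Bv i)).
(* If [s < 1], this [r] exceeds the supremum and still lies in [T]: [1 - s] keeps it at most 1, and
   [d] keeps [v] contracted by [r B]. *)
pose r := s + Num.min d (1 - s).
have d'0 : 0 < Num.min d (1 - s) by rewrite lt_min d0 subr_gt0.
have : T r.
  split.
    apply/andP; split; first by rewrite addr_ge0 // ltW.
    by rewrite -lerBrDl ge_min lexx orbT.
  exists v; split => // i; have := dv i.
  rewrite /r -!scalemxAl scalerDl ![in X in _ -> X]mxE.
  have /(_ i) := nonneg_mx_mulmx_ge0 _ _ _ _ B0 (fun i => ltW (v0 i)).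
  rewrite !mxE; set b := \sum_j _ => b0.
  have : Num.min d (1 - s) <= d by rewrite ge_min lexx.
  nra.
move=> Tr; have : r <= s by apply: ub_le_sup => //; case: supT.
by rewrite leNgt ltrDl d'0.
Qed.

(** * Componentwise order, the pairing [dot], and entrywise convergence *)

Lemma le_vec_anti (R : realType) (n : nat) (x y : 'cV[R]_n) :
  le_vec x y -> le_vec y x -> x = y.
Proof.
by move=> xy yx; apply/colP => i; apply/eqP; rewrite eq_le xy yx.
Qed.

Lemma orthant_le_vec (R : realType) (n : nat) (x y : 'cV[R]_n) :
  orthant x -> le_vec x y -> orthant y.
Proof. by move=> x0 xy i; exact: le_trans (x0 i) (xy i). Qed.

Lemma addvE (R : realType) (n : nat) (x y : 'cV[R]_n) i :
  (x + y) i 0 = x i 0 + y i 0.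
Proof. by rewrite mxE. Qed.

Lemma subvE (R : realType) (n : nat) (x y : 'cV[R]_n) i :
  (x - y) i 0 = x i 0 - y i 0.
Proof. by rewrite !mxE. Qed.

Lemma dotE (R : realType) (n : nat) (c x : 'cV[R]_n) :
  dot c x = \sum_i c i 0 * x i 0.
Proof. by rewrite /dot mxE; apply: eq_bigr => i _; rewrite mxE. Qed.

Lemma dotDl (R : realType) (n : nat) (c d x : 'cV[R]_n) :
  dot (c + d) x = dot c x + dot d x.
Proof. by rewrite /dot linearD /= mulmxDl mxE. Qed.

Lemma dotZl (R : realType) (n : nat) (a : R) (c x : 'cV[R]_n) :
  dot (a *: c) x = a * dot c x.
Proof. by rewrite /dot linearZ /= -scalemxAl mxE. Qed.

Lemma dotZr (R : realType) (n : nat) (a : R) (c x : 'cV[R]_n) :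
  dot c (a *: x) = a * dot c x.
Proof. by rewrite /dot -scalemxAr mxE. Qed.

Lemma dot_mulmxr (R : realType) (n : nat) (A : 'M[R]_n) (c x : 'cV[R]_n) :
  dot c (A *m x) = dot (A^T *m c) x.
Proof. by rewrite /dot trmx_mul trmxK mulmxA. Qed.

Lemma dot_delta (R : realType) (n : nat) (c : 'cV[R]_n) i :
  dot c (delta_mx i 0) = c i 0.
Proof. by rewrite /dot -colE !mxE. Qed.

Lemma dot_ge0 (R : realType) (n : nat) (c x : 'cV[R]_n) :
  orthant c -> orthant x -> 0 <= dot c x.
Proof.
by move=> c0 x0; rewrite dotE; apply: sumr_ge0 => i _; rewrite mulr_ge0.
Qed.

Lemma dot_le (R : realType) (n : nat) (c d x : 'cV[R]_n) :
  le_vec c d -> orthant x -> dot c x <= dot d x.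
Proof.
by move=> cd x0; rewrite !dotE; apply: ler_sum => i _; rewrite ler_wpM2r.
Qed.

Lemma cvg_colP (R : realType) (n : nat) (c : nat -> 'cV[R]_n) (l : 'cV[R]_n) :
  c k @[k --> \oo] --> l <->
  forall i, c k i 0 @[k --> \oo] --> l i 0.
Proof.
split=> [cl i|cl].
  exact: (cvg_comp c (fun M : 'cV[R]_n => M i 0) cl (@coord_continuous _ _ _ i 0 l)).
move=> S [Q lQ QS].
have : \forall k \near \oo, forall i, Q i 0 (c k i 0).
  by apply: filter_forall => i; exact: cl (lQ i 0).
by apply: filterS => k Qk; apply: QS => i j; rewrite (ord1 j).
Qed.

Lemma cvg_dot (R : realType) (n : nat) (c : nat -> 'cV[R]_n) (l x : 'cV[R]_n) :
  c k @[k --> \oo] --> l -> dot (c k) x @[k --> \oo] --> dot l x.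
Proof.
move=> /cvg_colP cl; under eq_cvg do rewrite dotE.
rewrite dotE; apply: cvg_big => [|i _]; first exact: add_continuous.
exact: cvgMl.
Qed.

(** * Linear description of the good policies and their cost vectors *)

Section Problem.
Context {R : realType} {n : nat} {P : semilinear_problem R n}.

Local Notation X := (state P).
Local Notation alpha := (discount P).

Implicit Types (x : X) (c d : 'cV[R]_n) (mu nu : X -> control P).

Lemma state_val x : X (val x).
Proof. by have := valP x; rewrite inE. Qed.

Lemma orthant_val x : orthant (val x).
Proof. exact: state_ge0 (state_val x). Qed.

Lemma val_next_state x u :
  admissible x u -> val (next_state x u) = dynamics x u.
Proof. by move=> xu; rewrite insubdK // inE; exact: dynamics_state. Qed.

Lemma policy_mxP mu : good_policy mu ->
  nonneg_mx (policy_mx mu) /\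
  forall x, dynamics x (mu x) = policy_mx mu *m val x.
Proof.
move=> /good_policy_linear[A [q [A0 Aq]]].
have [] := @xgetPex _ 0 [set A : 'M[R]_n |
    nonneg_mx A /\ forall x : X, dynamics x (mu x) = A *m val x]; last by [].
by exists A; split => // x; have [] := Aq x.
Qed.

Lemma policy_vecP mu : good_policy mu ->
  forall x, stage_cost x (mu x) = dot (policy_vec mu) (val x).
Proof.
move=> /good_policy_linear[A [q [A0 Aq]]].
apply: (@xgetPex _ 0 [set q : 'cV[R]_n |
    forall x : X, stage_cost x (mu x) = dot q (val x)]).
by exists q => x; have [] := Aq x.
Qed.

(** The transpose appears because this matrix acts on cost vectors, not on states: it is the linear
    part of [policy_bellman mu]. *)
Definition cost_mx mu : 'M[R]_n := (alpha *: policy_mx mu)^T.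

Lemma policy_bellmanE mu c :
  policy_bellman mu c = policy_vec mu + cost_mx mu *m c.
Proof. by rewrite /policy_bellman /cost_mx linearZ /= scalemxAl. Qed.

Lemma cost_mx_ge0 mu : good_policy mu -> nonneg_mx (cost_mx mu).
Proof.
move=> /policy_mxP[A0 _] i j; rewrite !mxE mulr_ge0 //.
exact/ltW/discount_gt0.
Qed.

Lemma val_next_policy mu x : good_policy mu ->
  val (next_state x (mu x)) = policy_mx mu *m val x.
Proof.
move=> gmu; rewrite val_next_state; last exact: good_policy_admissible.
by case: (policy_mxP _ gmu).
Qed.

Lemma dot_cost_mx mu c x : good_policy mu ->
  dot (cost_mx mu *m c) (val x) = alpha * dot c (val (next_state x (mu x))).
Proof.
move=> gmu; rewrite val_next_policy // dot_mulmxr /cost_mx linearZ /=.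
by rewrite -scalemxAl dotZl.
Qed.

Lemma Qvalue_policy mu c x : good_policy mu ->
  Qvalue c x (mu x) = dot (policy_bellman mu c) (val x).
Proof.
move=> gmu; rewrite policy_bellmanE dotDl dot_cost_mx // /Qvalue.
by rewrite policy_vecP // val_next_state //; exact: good_policy_admissible.
Qed.

Lemma policy_bellman_le mu c d : good_policy mu -> le_vec c d ->
  le_vec (policy_bellman mu c) (policy_bellman mu d).
Proof.
move=> gmu cd i; rewrite !policy_bellmanE !addvE lerD2l.
exact: nonneg_mx_mulmx_le (cost_mx_ge0 _ gmu) cd i.
Qed.

Lemma stable_cost_mx mu : good_policy mu ->
  policy_stable mu <-> contracting (cost_mx mu).
Proof.
move=> gmu; split=> [|cmu].
  move=> /stable_mx_tr; exact: stable_contracting (cost_mx_ge0 _ gmu).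
rewrite /policy_stable -[_ *: _]trmxK; apply: stable_mx_tr.
exact: contracting_stable (cost_mx_ge0 _ gmu) cmu.
Qed.

(** The term [policy_vec mu] cancels, so [y = c - d] satisfies [y >= B y] with [B = cost_mx mu]
    contracting, and [contracting_ge0] applies. *)
Lemma policy_bellman_comparison mu c d :
  good_policy mu -> policy_stable mu ->
  le_vec (policy_bellman mu c) c -> le_vec d (policy_bellman mu d) ->
  le_vec d c.
Proof.
move=> gmu /(stable_cost_mx _ gmu) smu cc dd.
suff : orthant (c - d) by move=> h i; have := h i; rewrite !mxE subr_ge0.
apply: (contracting_ge0 _ _ _ _ (cost_mx_ge0 _ gmu) smu) => i.
have := cc i; have := dd i; rewrite !policy_bellmanE mulmxBr.
by rewrite !subvE !addvE; lra.
Qed.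

Lemma policy_cost_vec_fixed mu : good_policy mu -> policy_stable mu ->
  1%:M - alpha *: policy_mx mu \in unitmx /\
  policy_bellman mu (policy_cost_vec mu) = policy_cost_vec mu.
Proof.
move=> gmu /(stable_cost_mx _ gmu) smu.
have u : 1%:M - alpha *: policy_mx mu \in unitmx.
  rewrite -unitmx_tr linearB /= trmx1.
  exact: contracting_unitmx (cost_mx_ge0 _ gmu) smu.
split => //; rewrite policy_bellmanE.
have := congr1 trmx (mulmxKV u (policy_vec mu)^T).
rewrite trmx_mul trmxK -/(policy_cost_vec mu) linearB /= trmx1 -/(cost_mx mu).
by rewrite mulmxBl mul1mx => <-; rewrite subrK.
Qed.

(** * From inequalities at states to inequalities between vectors *)

Section Cone.
Context (hX : state_space_structure P).

(** The [i]-th basis vector is a multiple of a state. As it is nonzero, so are the factor and the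
    state, and the latter is what observability asks for. *)
Lemma coord_state i : exists (x : X) (s : R),
  [/\ 0 < s, val x != 0 & forall c, c i 0 = s * dot c (val x)].
Proof.
have [j|x [s [s0 sx]]] := hX (delta_mx i 0).
  by rewrite mxE ler0n.
have dn0 : delta_mx i 0 != 0 :> 'cV[R]_n.
  by apply/eqP => /colP/(_ i)/eqP; rewrite !mxE !eqxx oner_eq0.
exists x, s; split.
- rewrite lt_neqAle s0 andbT; apply: contraNneq dn0 => s00.
  by rewrite -sx -s00 scale0r.
- by apply: contraNneq dn0 => x0; rewrite -sx x0 scaler0.
- by move=> c; rewrite -dotZr sx dot_delta.
Qed.

Lemma le_vec_state c d :
  (forall x, dot c (val x) <= dot d (val x)) -> le_vec c d.
Proof.
move=> cd i; have [x [s [s0 _ sx]]] := coord_state i.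
by rewrite !sx ler_pM2l.
Qed.

Lemma eq_vec_state c d : (forall x, dot c (val x) = dot d (val x)) -> c = d.
Proof. by move=> cd; apply: le_vec_anti; apply: le_vec_state => x; rewrite cd. Qed.

Lemma policy_vec_ge0 mu : good_policy mu -> orthant (policy_vec mu).
Proof.
move=> gmu i; have [x [s [s0 _ sx]]] := coord_state i.
rewrite sx mulr_ge0 ?(ltW s0) // -policy_vecP //; apply: stage_cost_ge0.
exact: good_policy_admissible.
Qed.

(** Comparison with the vector 0, for which [0 <= policy_vec mu = policy_bellman mu 0]. *)
Lemma policy_cost_vec_ge0 mu : good_policy mu -> policy_stable mu ->
  orthant (policy_cost_vec mu).
Proof.
move=> gmu smu; have [_ fix_mu] := policy_cost_vec_fixed _ gmu smu.
have h : le_vec 0 (policy_cost_vec mu).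
  apply: (policy_bellman_comparison _ _ _ gmu smu) => i; first by rewrite fix_mu.
  by rewrite policy_bellmanE mulmx0 addr0 mxE policy_vec_ge0.
by move=> i; have := h i; rewrite mxE.
Qed.

End Cone.

(** * Costs along the trajectory of a policy, and stability from observability *)

Lemma policy_trajectoryS mu x k :
  policy_trajectory mu x k.+1 =
  next_state (policy_trajectory mu x k) (mu (policy_trajectory mu x k)).
Proof. by []. Qed.

Lemma trajectory_policy mu x k :
  trajectory x (fun j => mu (policy_trajectory mu x j)) k =
  policy_trajectory mu x k.
Proof. by elim: k => //= k ->. Qed.

Definition partial_cost mu N x : R :=
  \sum_(0 <= k < N) alpha ^+ k *
    stage_cost (policy_trajectory mu x k) (mu (policy_trajectory mu x k)).

(** The hypothesis, evaluated at the [k]-th state and weighted by [alpha ^+ k], telescopes. The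
    terminal term is kept because it equals [dot (B^N c) (val x)] with [B = cost_mx mu]. *)
Lemma partial_cost_le mu c N x :
  good_policy mu -> le_vec (policy_bellman mu c) c ->
  partial_cost mu N x + alpha ^+ N * dot c (val (policy_trajectory mu x N)) <=
  dot c (val x).
Proof.
move=> gmu cc; elim: N => [|N IH].
  by rewrite /partial_cost big_geq // add0r expr0 mul1r.
apply: le_trans IH; rewrite /partial_cost big_nat_recr //= -addrA lerD2l.
rewrite exprSr -mulrA -mulrDr ler_wpM2l ?exprn_ge0 ?(ltW (discount_gt0 P)) //.
set y := policy_trajectory mu x N.
have := dot_le _ _ _ _ _ cc (orthant_val y).
by rewrite policy_bellmanE dotDl dot_cost_mx // policy_vecP.
Qed.

Lemma iter_cost_mx_ge0 mu c k : good_policy mu -> orthant c ->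
  orthant (iter k (mulmx (cost_mx mu)) c).
Proof.
move=> gmu c0; elim: k => //= k IH.
exact: nonneg_mx_mulmx_ge0 (cost_mx_ge0 _ gmu) IH.
Qed.

Lemma dot_iter_cost_mx mu c k x : good_policy mu ->
  dot (iter k (mulmx (cost_mx mu)) c) (val x) =
  alpha ^+ k * dot c (val (policy_trajectory mu x k)).
Proof.
move=> gmu; elim: k c => [|k IH] c; first by rewrite expr0 mul1r.
by rewrite iterSr IH dot_cost_mx // policy_trajectoryS exprSr mulrA.
Qed.

Lemma policy_cost_ge0 mu x k : good_policy mu ->
  0 <= alpha ^+ k *
    stage_cost (policy_trajectory mu x k) (mu (policy_trajectory mu x k)).
Proof.
move=> gmu; rewrite mulr_ge0 ?exprn_ge0 ?(ltW (discount_gt0 P)) //.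
apply: stage_cost_ge0; exact: good_policy_admissible.
Qed.

(* Observability makes the N-stage cost positive, so that c strictly dominates
   (cost_mx mu)^N c; then v = sum_(k < N) (cost_mx mu)^k c is contracted. *)
Lemma superharmonic_stable (hX : state_space_structure P)
    (hO : observability P) mu c :
  good_policy mu -> orthant c -> le_vec (policy_bellman mu c) c ->
  policy_stable mu.
Proof.
move=> gmu c0 cc; apply/(stable_cost_mx _ gmu).
have [N obs] := hO.
set B := cost_mx mu.
have iterN i : iter N (mulmx B) c i 0 < c i 0.
  have [x [s [s0 xn0 sx]]] := coord_state hX i.
  rewrite !sx ltr_pM2l // dot_iter_cost_mx //.
  apply: lt_le_trans (partial_cost_le _ _ N x gmu cc).
  rewrite ltrDr -lte_fin; apply: lt_le_trans (obs x xn0) _.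
  apply: ereal_inf_lbound.
  exists (fun k => mu (policy_trajectory mu x k)).
    by move=> k _; rewrite trajectory_policy; exact: good_policy_admissible.
  by congr EFin; apply: eq_bigr => k _; rewrite trajectory_policy.
have iter0 k := iter_cost_mx_ge0 _ _ k gmu c0.
(* Shifting the sum [v] gives [B v + c = v + B^N c], and [B^N c < c] yields [B v < v]. *)
exists (\sum_(k < N) iter k (mulmx B) c); split => i; last first.
  have : B *m (\sum_(k < N) iter k (mulmx B) c) + c =
         \sum_(k < N) iter k (mulmx B) c + iter N (mulmx B) c.
    have : \sum_(k < N.+1) iter k (mulmx B) c =
           c + \sum_(k < N) B *m iter k (mulmx B) c by rewrite big_ord_recl.
    by rewrite -mulmx_sumr big_ord_recr /= => ->; exact: addrC.
  move=> /colP/(_ i); have := iterN i.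
  by rewrite !addvE; lra.
(* [N = 0] would read [c_i < c_i]. Otherwise the first summand is [c], which is positive since
   [0 <= B^N c < c]. *)
have := iterN i; case: (N) => [|M _]; first by rewrite ltxx.
rewrite big_ord_recl mxE ltr_pwDl //.
  exact: le_lt_trans (iter0 N i) (iterN i).
by rewrite summxE sumr_ge0 // => k _; exact: iter0.
Qed.

(** * The Bellman operator: monotonicity, greedy policies, continuity *)

Section Bellman.
Context (hCA : closure_attainability P).

Lemma bellmanP c : orthant c -> bellman_vec P c (bellman P c).
Proof.
case: hCA => hc _ _ /hc[ch [hch _]]; apply: xgetPex; by exists ch.
Qed.

Lemma bellman_ge0 c : orthant c -> orthant (bellman P c).
Proof. by move=> /bellmanP[]. Qed.

Lemma bellman_le_Qvalue c x u : orthant c -> admissible x u ->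
  dot (bellman P c) (val x) <= Qvalue c x u.
Proof. by move=> /bellmanP[_ /(_ x)[_ lb]] xu; apply: lb; exists u. Qed.

Lemma bellman_attained c x : orthant c ->
  exists2 u, admissible x u & Qvalue c x u = dot (bellman P c) (val x).
Proof. by move=> /bellmanP[_ /(_ x)[]]. Qed.

Context (hX : state_space_structure P).

Lemma bellman_le_policy mu c : good_policy mu -> orthant c ->
  le_vec (bellman P c) (policy_bellman mu c).
Proof.
move=> gmu c0; apply: le_vec_state => // x; rewrite -Qvalue_policy //.
exact: bellman_le_Qvalue (good_policy_admissible gmu x).
Qed.

(** At each state, a control that is minimizing for [d] is a candidate for [c]. *)
Lemma bellman_le c d : orthant c -> le_vec c d ->
  le_vec (bellman P c) (bellman P d).
Proof.
move=> c0 cd; apply: le_vec_state => // x.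
have [u xu <-] := bellman_attained d x (orthant_le_vec _ _ _ _ c0 cd).
apply: le_trans (bellman_le_Qvalue _ _ _ c0 xu) _.
rewrite lerD2l ler_wpM2l ?(ltW (discount_gt0 P)) //; apply: dot_le => //.
by rewrite -val_next_state //; exact: orthant_val.
Qed.

Lemma exists_greedy c : orthant c ->
  exists2 nu : X -> control P, good_policy nu & policy_bellman nu c = bellman P c.
Proof.
move=> c0; have [_ _ /(_ c c0)[nu [gnu greedy_nu]]] := hCA.
exists nu => //; apply: le_vec_anti; last exact: bellman_le_policy.
apply: le_vec_state => // x; rewrite -Qvalue_policy //.
have [u xu <-] := bellman_attained c x c0.
by have [_ ->] := greedy_nu x.
Qed.

Lemma bellman_cvg (c : nat -> 'cV[R]_n) l :
  (forall k, orthant (c k)) -> orthant l -> c k @[k --> \oo] --> l ->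
  bellman P (c k) @[k --> \oo] --> bellman P l.
Proof.
move=> c0 l0 cl; have [_ /subspace_continuousP/(_ l l0) contl _] := hCA.
(* Continuity is only relative to the orthant, which the sequence never leaves. *)
apply: (cvg_comp c (bellman P) _ contl) => S; rewrite /within /= => lS.
have : \forall k \near \oo, orthant (c k) -> S (c k) by exact: cl _ lS.
by apply: filterS => k; apply; exact: c0.
Qed.

(** * Uniqueness of the fixed point and value iteration from zero *)

Context (hO : observability P).

(** A greedy policy [nu] at [d] satisfies [policy_bellman nu d = d], hence is stable. Since
    [c = bellman P c <= policy_bellman nu c], comparison gives [c <= d]; then exchange the roles. *)
Lemma bellman_fixed_unique c d : orthant c -> orthant d ->
  bellman P c = c -> bellman P d = d -> c = d.
Proof.
suff le_cd (c' d' : 'cV[R]_n) : orthant c' -> orthant d' ->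
    bellman P c' = c' -> bellman P d' = d' -> le_vec c' d'.
  by move=> *; apply: le_vec_anti; apply: le_cd.
move=> c0 d0 cE dE; have [nu gnu nud] := exists_greedy d' d0.
have nud' : policy_bellman nu d' = d' by rewrite nud.
have dd : le_vec (policy_bellman nu d') d' by rewrite nud' => i.
have snu := superharmonic_stable hX hO _ _ gnu d0 dd.
apply: (policy_bellman_comparison _ _ _ gnu snu dd).
by rewrite -[X in le_vec X _]cE; exact: bellman_le_policy.
Qed.

Lemma cvg_orthant (c : nat -> 'cV[R]_n) :
  (forall k, orthant (c k)) -> (forall i, cvgn (fun k => c k i 0)) ->
  exists2 l, orthant l & c k @[k --> \oo] --> l.
Proof.
move=> c0 ccvg; exists (\col_i limn (fun k => c k i 0)).
  by move=> i; rewrite mxE; apply: limr_ge => //; apply: nearW => k; exact: c0.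
by apply/cvg_colP => i; rewrite mxE; exact: ccvg.
Qed.

Lemma value_iteration_le d : orthant d -> bellman P d = d ->
  forall k, le_vec 0 (iter k (bellman P) 0) /\
    le_vec (iter k (bellman P) 0) (iter k.+1 (bellman P) 0) /\
    le_vec (iter k (bellman P) 0) d.
Proof.
move=> d0 dE; have o0 : orthant (0 : 'cV[R]_n) by move=> i; rewrite mxE.
elim=> [|k [IH0 [IHS IHd]]].
  split; first by [].
  by split=> i; rewrite mxE ?d0 //; exact: bellman_ge0.
have ok : orthant (iter k (bellman P) 0) by apply: orthant_le_vec IH0.
have h0 : le_vec 0 (iter k.+1 (bellman P) 0).
  by move=> i; rewrite mxE; exact: bellman_ge0.
split => //; split; first exact: bellman_le.
by rewrite -dE; exact: bellman_le.
Qed.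

(** The iterates increase and stay below [d]; by continuity their limit is a fixed point, and
    uniqueness identifies it with [d]. *)
Lemma value_iteration_cvg d : orthant d -> bellman P d = d ->
  iter k (bellman P) 0 @[k --> \oo] --> d.
Proof.
move=> d0 dE; have vi := value_iteration_le d d0 dE.
pose c k := iter k (bellman P) 0.
have c0 k : orthant (c k).
  by have [h _] := vi k; move=> i; have := h i; rewrite mxE.
have [i|l l0 cl] := cvg_orthant c c0.
  apply: nondecreasing_is_cvgn.
    by apply/nondecreasing_seqP => k; have [_ []] := vi k.
  by exists (d i 0) => _ [k _ <-]; have [_ []] := vi k.
suff -> : d = l by [].
apply: bellman_fixed_unique => //.
apply/colP => i.
have /cvg_colP/(_ i) h1 := bellman_cvg c l c0 l0 cl.
have /cvg_colP/(_ i) h2 := cl.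
apply: cvg_unique h1 _ => //.
by rewrite -(cvg_shiftS (fun k => c k i 0)) in h2.
Qed.

(** [trajectory] unfolds at its last step; the dynamic programming induction peels off the first
    one. *)
Lemma trajectoryS x (u : nat -> control P) k :
  trajectory x u k.+1 = trajectory (next_state x (u 0%N)) (u \o S) k.
Proof. by elim: k => //= k <-. Qed.

Lemma value_iteration_le_cost (u : nat -> control P) k x :
  (forall j, admissible (trajectory x u j) (u j)) ->
  dot (iter k (bellman P) 0) (val x) <=
  \sum_(0 <= j < k) alpha ^+ j * stage_cost (trajectory x u j) (u j).
Proof.
have o0 : orthant (0 : 'cV[R]_n) by move=> i; rewrite mxE.
elim: k x u => [|k IH] x u adm.
  by rewrite big_geq //= dotE big1 // => i _; rewrite mxE mul0r.
have ok : orthant (iter k (bellman P) 0).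
  by elim: (k) => //= j; exact: bellman_ge0.
apply: le_trans (bellman_le_Qvalue _ _ _ ok (adm 0%N)) _.
rewrite big_nat_recl //= expr0 mul1r lerD2l -val_next_state; last exact: adm 0%N.
apply: le_trans (ler_wpM2l _ (IH _ (u \o S) _)) _.
- exact/ltW/discount_gt0.
- by move=> j; rewrite -trajectoryS; exact: adm j.+1.
- rewrite mulr_sumr; apply: ler_sum => j _.
  by rewrite -trajectoryS exprS mulrA.
Qed.

(** * The fixed point is the optimal cost vector *)

Lemma fixed_point_le_cost d x : orthant d -> bellman P d = d ->
  ((dot d (val x))%:E <= optimal_cost x)%E.
Proof.
move=> d0 dE; apply: le_ereal_inf_tmp => _ [u adm <-].
pose cost j := alpha ^+ j * stage_cost (trajectory x u j) (u j).
have cost0 j : 0 <= cost j.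
  rewrite mulr_ge0 ?exprn_ge0 ?(ltW (discount_gt0 P)) //.
  by apply: stage_cost_ge0; exact: adm.
have le_series k : ((dot (iter k (bellman P) 0) (val x))%:E <=
    \sum_(0 <= j <oo) (cost j)%:E)%E.
  apply: le_trans (nneseries_lim_ge k _); last by move=> j _ _; rewrite lee_fin.
  by rewrite sumEFin lee_fin; exact: value_iteration_le_cost.
have cvg_vi := cvg_dot _ _ _ _ (val x) (value_iteration_cvg d d0 dE).
(* A finite total bounds the limit [d] of value iteration; an infinite one is trivial, and [-oo]
   contradicts the bound at [k = 0]. *)
move: (\sum_(0 <= j <oo) _)%E le_series => [r| |] le_r.
- rewrite lee_fin; apply: (cvgr_to_le cvg_vi); apply: nearW => k.
  by rewrite -lee_fin; exact: le_r.
- by rewrite leey.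
- by have := le_r 0%N; rewrite leeNy_eq.
Qed.

Lemma optimal_cost_le_policy mu x : good_policy mu ->
  (optimal_cost x <= policy_cost mu x)%E.
Proof.
move=> gmu; apply: ereal_inf_lbound.
exists (fun k => mu (policy_trajectory mu x k)).
  by move=> k; rewrite trajectory_policy; exact: good_policy_admissible.
by apply: eq_eseriesr => k _; rewrite trajectory_policy.
Qed.

(** Drop the nonnegative terminal term of [partial_cost_le] and let the horizon grow. *)
Lemma policy_cost_le mu c x : good_policy mu -> orthant c ->
  le_vec (policy_bellman mu c) c -> (policy_cost mu x <= (dot c (val x))%:E)%E.
Proof.
move=> gmu c0 cc; apply: lime_le.
  by apply: is_cvg_nneseries => k _ _; rewrite lee_fin; exact: policy_cost_ge0.
apply: nearW => N; rewrite sumEFin lee_fin.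
apply: le_trans (partial_cost_le _ _ N x gmu cc).
rewrite lerDl mulr_ge0 ?exprn_ge0 ?(ltW (discount_gt0 P)) //.
exact: dot_ge0 (orthant_val _).
Qed.

Lemma fixed_point_optimal_cost d x : orthant d -> bellman P d = d ->
  optimal_cost x = (dot d (val x))%:E.
Proof.
move=> d0 dE; have [nu gnu nud] := exists_greedy d d0.
apply/eqP; rewrite eq_le fixed_point_le_cost // andbT.
apply: le_trans (optimal_cost_le_policy nu x gnu) _.
by apply: policy_cost_le => // i; rewrite nud dE.
Qed.

Lemma optimal_cost_vecE d : orthant d -> bellman P d = d ->
  optimal_cost_vec P = d.
Proof.
move=> d0 dE; apply: xget_unique => [|c [_ cE]].
  by split=> // x; exact: fixed_point_optimal_cost.
apply: eq_vec_state => // x; apply: EFin_inj.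
by rewrite -cE; exact: fixed_point_optimal_cost.
Qed.

(** * Policy improvement and convergence of the cost vectors *)

Lemma bellman_le_cost_vec mu : good_policy mu -> policy_stable mu ->
  le_vec (bellman P (policy_cost_vec mu)) (policy_cost_vec mu).
Proof.
move=> gmu smu; have [_ fix_mu] := policy_cost_vec_fixed _ gmu smu.
rewrite -[X in le_vec _ X]fix_mu; apply: bellman_le_policy => //.
exact: policy_cost_vec_ge0.
Qed.

Lemma iteration_defined_stable mu : good_policy mu -> policy_stable mu ->
  iteration_defined mu.
Proof.
move=> gmu smu; have c0 := policy_cost_vec_ge0 hX _ gmu smu.
split => //; first by have [] := policy_cost_vec_fixed _ gmu smu.
by have [nu gnu nuE] := exists_greedy _ c0; exists nu.
Qed.

Lemma policy_improvement_stable mu nu :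
  good_policy mu -> policy_stable mu -> policy_improvement mu nu ->
  policy_stable nu.
Proof.
move=> gmu smu [gnu nuE].
apply: (superharmonic_stable hX hO _ _ gnu (policy_cost_vec_ge0 hX _ gmu smu)).
by rewrite nuE; exact: bellman_le_cost_vec.
Qed.

(** Comparison first gives [c_nu <= c_mu]; applying the monotone [policy_bellman nu] sharpens this
    to [c_nu <= policy_bellman nu c_mu = bellman P c_mu]. *)
Lemma policy_improvement_le mu nu :
  good_policy mu -> policy_stable mu -> policy_improvement mu nu ->
  le_vec (policy_cost_vec nu) (bellman P (policy_cost_vec mu)).
Proof.
move=> gmu smu imp; have snu := policy_improvement_stable _ _ gmu smu imp.
have [gnu nuE] := imp; have [_ fix_nu] := policy_cost_vec_fixed _ gnu snu.
rewrite -nuE -[X in le_vec X _]fix_nu; apply: policy_bellman_le => //.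
apply: (policy_bellman_comparison _ _ _ gnu snu); last by rewrite fix_nu.
by rewrite nuE; exact: bellman_le_cost_vec.
Qed.

(** Both inequalities in [c_(k+1) <= bellman P c_k <= c_k] pass to the limit, so
    [l <= bellman P l <= l]. *)
Lemma policy_iteration_cvg (mu : nat -> X -> control P) :
  (forall k, good_policy (mu k) /\ policy_stable (mu k)) ->
  (forall k, policy_improvement (mu k) (mu k.+1)) ->
  exists l, [/\ orthant l, bellman P l = l &
    policy_cost_vec (mu k) @[k --> \oo] --> l].
Proof.
move=> gs imp; pose c k := policy_cost_vec (mu k).
have c0 k : orthant (c k) by have [? ?] := gs k; exact: policy_cost_vec_ge0.
have cG k : le_vec (bellman P (c k)) (c k).
  by have [? ?] := gs k; exact: bellman_le_cost_vec.
have Gc k : le_vec (c k.+1) (bellman P (c k)).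
  by have [? ?] := gs k; exact: policy_improvement_le.
have [i|l l0 cl] := cvg_orthant c c0.
  apply: nonincreasing_is_cvgn.
    by apply/nonincreasing_seqP => k; exact: le_trans (Gc k i) (cG k i).
  by exists 0 => _ [k _ <-]; exact: c0.
exists l; split => //.
have Gl := bellman_cvg c l c0 l0 cl.
have /cvg_colP cl' := cl; have /cvg_colP Gl' := Gl.
apply: le_vec_anti => i.
  by apply: ler_cvg_to (Gl' i) (cl' i) _; apply: nearW => k; exact: cG.
have := cl' i; rewrite -(cvg_shiftS (fun k => c k i 0)) => clS.
by apply: ler_cvg_to clS (Gl' i) _; apply: nearW => k; exact: Gc.
Qed.

Lemma optimal_policy_cost_vec mu : good_policy mu -> policy_stable mu ->
  bellman P (policy_cost_vec mu) = policy_cost_vec mu -> optimal_policy mu.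
Proof.
move=> gmu smu cE; split=> [x|x]; first exact: good_policy_admissible.
have c0 := policy_cost_vec_ge0 hX _ gmu smu.
have [_ fix_mu] := policy_cost_vec_fixed _ gmu smu.
apply/eqP; rewrite eq_le optimal_cost_le_policy // andbT.
rewrite (fixed_point_optimal_cost _ _ c0 cE).
by apply: policy_cost_le => // i; rewrite fix_mu.
Qed.

End Bellman.
End Problem.

(** * Finitely many policies, and the three claims together *)

(** The finite set [A] without [l] is closed, so its complement is a neighbourhood of [l], and it
    meets [A] at most in [l]. *)
Lemma cvg_finite_range (T : topologicalType) (u : nat -> T) (l : T) (A : set T) :
  hausdorff_space T -> finite_set A -> (forall k, A (u k)) ->
  u k @[k --> \oo] --> l -> \forall k \near \oo, u k = l.
Proof.
move=> hT finA uA ul.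
have clA : closed (A `\ l).
  apply: (accessible_finite_set_closed.1 (hausdorff_accessible hT)).
  exact: finite_setD.
have /ul : nbhs l (~` (A `\ l)).
  by apply: open_nbhs_nbhs; split; [rewrite openC|move=> [_ /(_ erefl)]].
move=> near_l; have : \forall k \near \oo, ~ (A `\ l) (u k) by exact: near_l.
by apply: filterS => k ukl; apply: contrapT => ne; apply: ukl.
Qed.

Theorem proposition5 (R : realType) (n : nat) (P : semilinear_problem R n)
    (hCA : closure_attainability P) (hS : stabilizability P)
    (hX : state_space_structure P) (hO : observability P) :
  (forall (K : nat) (mu : nat -> state P -> control P),
     policy_iteration_upto K mu ->
     (forall k : nat, (k <= K)%N ->
        [/\ good_policy (mu k), policy_stable (mu k)
          & iteration_defined (mu k)])) /\
  (forall mu : nat -> state P -> control P,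
     policy_iteration mu ->
     [/\ (forall k : nat, good_policy (mu k) /\ policy_stable (mu k)),
         policy_cost_vec (mu k) @[k --> \oo] --> optimal_cost_vec P
       & finite_set (@good_policy R n P) ->
           exists kbar : nat, forall k : nat, (kbar <= k)%N ->
             optimal_policy (mu k)]).
Proof.
split=> [K mu [g0 s0 imp] k kK|mu [g0 s0 imp]].
  have [gk sk] : good_policy (mu k) /\ policy_stable (mu k).
    elim: k kK => [_|k IH kK]; first by split.
    have [gk sk] := IH (ltnW kK); split; first by have [] := imp k kK.
    exact: (policy_improvement_stable hCA hX hO (mu k) (mu k.+1) gk sk) (imp k kK).
  by split=> [||]; [exact: gk|exact: sk|exact: iteration_defined_stable].
have gs k : good_policy (mu k) /\ policy_stable (mu k).
  elim: k => [|k [gk sk]]; first by split.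
  split; first by have [] := imp k.
  exact: (policy_improvement_stable hCA hX hO (mu k) (mu k.+1) gk sk) (imp k).
have [l [l0 lE cl]] := policy_iteration_cvg hCA hX hO mu gs imp.
split => //; first by rewrite (optimal_cost_vecE hCA hX hO l l0 lE).
move=> fin.
(* Finitely many policies have finitely many cost vectors, so these are eventually equal to [l],
   even if the policies keep changing. *)
have [kbar _ kbarP] : \forall k \near \oo, policy_cost_vec (mu k) = l.
  apply: (cvg_finite_range _ _ _ _ _ (finite_image _ fin) _ cl).
    exact: norm_hausdorff.
  by move=> k; exists (mu k) => //; have [] := gs k.
exists kbar => k kk; have [gk sk] := gs k.
by apply: optimal_policy_cost_vec => //; rewrite (kbarP k kk).
Qed.
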